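(* Let $p>0$ and let $r\ge 1$ be an integer. Consider the variance function of the ABM class, $V_p(m)=m\left(1+\frac{m}{p}\right)^{r}$ on $M=(0,\infty)$. Let $\psi_p$ and $\phi_p$ be the primitives on $(0,\infty)$ of $\frac{1}{V_p(m)}$ and $\frac{m}{V_p(m)}$, respectively, which fulfill the conditions $$\lim_{m\to 0^+}\phi_p'(m)=1,\qquad \lim_{m\to 0^+} m\exp\big(-\psi_p(m)\big)=p,\qquad \lim_{m\to 0^+}\phi_p(m)=0,$$ and put $G_p(m)=m\exp(-\psi_p(m))$. Then for all $m>0$, $$\psi_p(m)=\log\frac{m}{m+p}+\sum_{j=1}^{r-1}\frac1j\left(\frac{p^{j}}{(m+p)^{j}}-1\right),$$ $$\phi_p(m)=\begin{cases} p\log\frac{m+p}{p}, & r=1,\\[2pt] \frac{p}{r-1}\left(1-\left(\frac{p}{m+p}\right)^{r-1}\right), & r\ge 2,\end{cases}$$ $$G_p(m)=(m+p)\exp\left(\sum_{j=1}^{r-1}\frac1j\left(\frac{p^{j}}{(m+p)^{j}}-1\right)\right).$$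
   Context: An empty sum (the case $r=1$) equals $0$. A primitive of a function $f$ on an interval is a differentiable function $F$ with $F'=f$ there.
   Formalization: The formula for G_p is proved with a minus sign before the sum in the exponential, G_p(m)=(m+p)exp(-Σ...), because the printed plus sign contradicts G_p=m exp(-ψ_p) for r≥2 (e.g. p=1, r=2, m=1 gives 2e^{1/2}, not 2e^{-1/2}). *)

(* Defs.v *)
(* MathComp-Analysis *)
From mathcomp Require Import all_boot all_order all_algebra.
From mathcomp Require Import all_classical all_reals all_analysis.
Set Implicit Arguments.
Unset Strict Implicit.
Unset Printing Implicit Defensive.
Import Order.TTheory GRing.Theory Num.Theory.
Import numFieldNormedType.Exports.
Local Open Scope classical_set_scope.
Local Open Scope ring_scope.

(* Two-sided derivatives are required, so this is the usual notion when I is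
   an open interval. *)
Definition primitive_on (R : realType) (I : set R) (f F : R -> R) : Prop :=
  forall x : R, I x -> is_derive x 1 F (f x).

Definition abm_variance (R : realType) (p : R) (r : nat) (m : R) : R :=
  m * (1 + m / p) ^+ r.

Definition abm_G (R : realType) (psi : R -> R) (m : R) : R :=
  m * expR (- psi m).

(* A primitive psi of 1 / abm_variance p r, normalized by abm_G psi m --> p as
   m --> 0+, is ln (m / (m + p)) + abm_sum p r m. Hence abm_G psi m is
   (m + p) * expR (- abm_sum p r m), with a minus sign: for r >= 2 and m > 0,
   abm_sum p r m < 0, so the formula without it fails. *)
Definition abm_sum (R : realType) (p : R) (r : nat) (m : R) : R :=
  \sum_(1 <= j < r) j%:R^-1 * (p ^+ j / (m + p) ^+ j - 1).

(* Main.v *)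
(* On (0, oo), 1 / V_p(m) = q^r / m and m / V_p(m) = q^r with q = p / (m + p).
   The claimed formulas are primitives of these functions, so psi and phi
   differ from them by constants, which the limits at 0+ determine. The key
   identity is q^r / m - q^r / (m + p) = q^(r+1) / m: each new term of the sum
   turns the primitive for r into the one for r + 1. *)
Require Import Defs.
From mathcomp Require Import all_boot all_order all_algebra.
From mathcomp Require Import all_classical all_reals all_analysis.
From mathcomp Require Import ring.
Set Implicit Arguments.
Unset Strict Implicit.
Unset Printing Implicit Defensive.
Import Order.TTheory GRing.Theory Num.Theory.
Import numFieldNormedType.Exports.
Local Open Scope classical_set_scope.
Local Open Scope ring_scope.

(** The difference [F - G] has derivative 0, and the segment between two points of [i] stays in [i]
    by convexity, so the mean value theorem applies on it. *)
Lemma primitive_on_subr_const (R : realType) (i : interval R) (f F G : R -> R) :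
  primitive_on [set` i] f F -> primitive_on [set` i] f G ->
  {in i &, forall x y, F x - G x = F y - G y}.
Proof.
move=> dF dG.
have dFG z : z \in i -> is_derive z (1 : R) (F - G) 0.
  move=> zi; have dFz := dF z zi; have dGz := dG z zi.
  by apply: is_derive_eq; rewrite subrr.
suff le_const x y : x <= y -> x \in i -> y \in i -> F x - G x = F y - G y.
  by move=> x y xi yi; case: (leP x y) => [/le_const->//|/ltW/le_const->].
move=> xy xi yi.
have sub_i z : z \in `[x, y] -> z \in i.
  by rewrite in_itv/= => xzy; apply: (interval_is_interval xi yi).
have [||c _] := @MVT_segment R (F - G) (fun=> 0) x y xy.
- by move=> z /subset_itv_oo_cc/sub_i/dFG.
- by apply: derivable_within_continuous => z /sub_i/dFG dz; exact: ex_derive.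
by rewrite mul0r => /eqP; rewrite subr_eq0 => /eqP /esym.
Qed.

(** Serves at [x = 0]: the closed formulas are differentiable there, so their limits at 0+ are their
    values at 0. *)
Lemma is_derive_continuous_at_right (R : realType) (f : R -> R) (x df : R) :
  is_derive x (1 : R) f df -> f z @[z --> x^'+] --> f x.
Proof.
move=> [/derivable1_diffP/differentiable_continuous fx _].
exact: cvg_at_right_filter.
Qed.

Lemma eq_cvg_at_right (R : realType) (f g : R -> R) (a l : R) :
  (forall x, a < x -> f x = g x) ->
  f x @[x --> a^'+] --> l -> g x @[x --> a^'+] --> l.
Proof.
move=> fg; apply: cvg_trans; apply: near_eq_cvg.
by near=> x; rewrite fg//; near: x; exact: nbhs_right_gt.
Unshelve. all: by end_near. Qed.

Lemma is_derive_addr (R : realType) (p x : R) :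
  is_derive x (1 : R) (fun m => m + p) 1.
Proof.
have := is_deriveD (is_derive_id x (1 : R)) (is_derive_cst p x 1).
by rewrite addr0.
Qed.

Lemma is_derive_ratioX (R : realType) (p x : R) (n : nat) : x + p != 0 ->
  is_derive x (1 : R) (fun m => (p / (m + p)) ^+ n)
    (- (n%:R * (p / (x + p)) ^+ n / (x + p))).
Proof.
move=> xp0.
have -> : (fun m => (p / (m + p)) ^+ n) = (p \*: (fun m => (m + p)^-1)) ^+ n.
  by apply/funext => m; rewrite fctE.
have d := is_deriveX n
  (is_deriveZ p (is_deriveV (f := fun m => m + p) xp0 (is_derive_addr p x))).
apply: (is_derive_eq d); rewrite /GRing.scale/=.
(* The power rule produces the exponent [n.-1], which is a true predecessor only for positive [n];
   for [n = 0] both sides vanish. *)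
case: n {d} => [|n]; first by rewrite !mul0r oppr0.
by rewrite /= [in RHS]exprS /GRing.scale/=; field.
Qed.

(** The weight 1/j cancels the factor j from differentiating q^j, which leaves a plain sum of the
    terms q^j / (x + p). *)
Lemma is_derive_abm_sum (R : realType) (p x : R) (r : nat) : x + p != 0 ->
  is_derive x (1 : R) (abm_sum p r)
    (- \sum_(1 <= j < r) (p / (x + p)) ^+ j / (x + p)).
Proof.
move=> xp0.
have abm_sum_le1 n : (n <= 1)%N -> is_derive x (1 : R) (abm_sum p n)
    (- \sum_(1 <= j < n) (p / (x + p)) ^+ j / (x + p)).
  move=> n1; have -> : abm_sum p n = cst 0.
    by apply/funext => m; rewrite /abm_sum big_geq.
  by rewrite big_geq// oppr0; exact: is_derive_cst.
elim: r => [|[|r] IH]; [exact: abm_sum_le1|exact: abm_sum_le1|].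
have -> : abm_sum p r.+2 = abm_sum p r.+1 +
    r.+1%:R^-1 \*: ((fun m => (p / (m + p)) ^+ r.+1) - cst 1).
  by apply/funext => m; rewrite /abm_sum big_nat_recr//= -expr_div_n.
have d := is_deriveD IH (is_deriveZ r.+1%:R^-1
  (is_deriveB (is_derive_ratioX r.+1 xp0) (is_derive_cst (1 : R) x 1))).
apply: (is_derive_eq d); rewrite [in RHS]big_nat_recr//= subr0 opprD.
by rewrite /GRing.scale/= mulrN !mulrA mulVf ?pnatr_eq0// mul1r.
Qed.

Lemma abm_sum0 (R : realType) (p : R) (r : nat) : p != 0 -> abm_sum p r 0 = 0.
Proof.
move=> p0; rewrite /abm_sum big1// => j _.
by rewrite add0r divff ?expf_neq0// subrr mulr0.
Qed.

Lemma abm_varianceV (R : realType) (p m : R) (r : nat) : 0 < p -> 0 < m ->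
  (abm_variance p r m)^-1 = (p / (m + p)) ^+ r / m.
Proof.
move=> p0 m0; rewrite /abm_variance invfM mulrC -exprVn; congr (_ ^+ _ / _).
by field; rewrite !gt_eqF//= addr_gt0.
Qed.

Lemma is_derive_ln_addr (R : realType) (p x : R) : 0 < x + p ->
  is_derive x (1 : R) (fun m => ln (m + p)) (x + p)^-1.
Proof.
move=> xp0.
have := is_derive1_comp (g := fun m => m + p) (is_derive1_ln xp0)
  (is_derive_addr p x).
by rewrite mulr1.
Qed.

Lemma primitive_abm_psi (R : realType) (p : R) (r : nat) :
  0 < p -> (1 <= r)%N ->
  primitive_on `]0, +oo[ (fun m => 1 / abm_variance p r m)
    (fun m => ln m - ln (m + p) + abm_sum p r m).
Proof.
move=> p0 r1 x /=; rewrite in_itv/= andbT => x0.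
have xp0 : 0 < x + p by rewrite addr_gt0.
have xpN0 : x + p != 0 by rewrite gt_eqF.
have d := is_deriveD (is_deriveB (is_derive1_ln x0) (is_derive_ln_addr xp0))
  (is_derive_abm_sum r xpN0).
apply: (is_derive_eq d); rewrite div1r abm_varianceV//.
(* Telescoping by the key identity: [r = 1] is its case of exponent 0, namely 1/x - 1/(x + p) = q/x,
   and each later step subtracts the last term of the sum. *)
elim: r r1 {d} => // -[|r] IH _.
  by rewrite big_geq//; field; rewrite gt_eqF.
rewrite big_nat_recr//= opprD addrA IH// [in RHS]exprS.
by field; rewrite xpN0 gt_eqF.
Qed.

Definition abm_phi (R : realType) (p : R) (r : nat) (m : R) : R :=
  if r == 1%N then p * ln ((m + p) / p)
  else p / (r.-1)%:R * (1 - (p / (m + p)) ^+ r.-1).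

(** The range [0 < x + p] includes [x = 0], where continuity will give the limit of [abm_phi] at
    0+. *)
Lemma is_derive_abm_phi (R : realType) (p x : R) (r : nat) :
  0 < p -> 0 < x + p -> (1 <= r)%N ->
  is_derive x (1 : R) (abm_phi p r) ((p / (x + p)) ^+ r).
Proof.
move=> p0 xp0; have xpN0 : x + p != 0 by rewrite gt_eqF.
case: r => [//|[|r]] _.
  have d := is_deriveZ p
    (is_deriveB (is_derive_ln_addr xp0) (is_derive_cst (ln p) x 1)).
  (* The logarithm of the quotient splits only where [m + p] is positive; this holds near [x], which
     suffices for a derivative. *)
  apply: (near_eq_is_derive (f := p \*: ((fun m => ln (m + p)) - cst (ln p)))).
    near=> m; rewrite /abm_phi/= ln_div ?posrE//.
    rewrite -ltrBlDr sub0r; near: m.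
    by apply: lt_nbhsr; rewrite -subr_gt0 opprK.
  by apply: (is_derive_eq d); rewrite subr0 expr1.
have d := is_deriveZ (p / r.+1%:R)
  (is_deriveB (is_derive_cst (1 : R) x 1) (is_derive_ratioX r.+1 xpN0)).
apply: (is_derive_eq d); rewrite /GRing.scale/= sub0r opprK [RHS]exprS.
by field; rewrite xpN0/= addrC natr1 pnatr_eq0.
Unshelve. all: by end_near. Qed.

Lemma abm_phi0 (R : realType) (p : R) (r : nat) : p != 0 -> abm_phi p r 0 = 0.
Proof.
move=> p0; rewrite /abm_phi add0r divff// ln1 mulr0 expr1n subrr mulr0.
by case: ifP.
Qed.

Theorem proposition6 (R : realType) (p : R) (r : nat) (psi phi : R -> R)
  (p_gt0 : 0 < p) (r_ge1 : (1 <= r)%N)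
  (psi_primitive : primitive_on `]0, +oo[
     (fun m => 1 / abm_variance p r m) psi)
  (phi_primitive : primitive_on `]0, +oo[
     (fun m => m / abm_variance p r m) phi)
  (dphi_lim : derive1 phi m @[m --> 0^'+] --> (1 : R))
  (psi_lim : m * expR (- psi m) @[m --> 0^'+] --> p)
  (phi_lim : phi m @[m --> 0^'+] --> (0 : R)) :
  forall m : R, 0 < m ->
    [/\ psi m = ln (m / (m + p)) + abm_sum p r m,
        phi m = (if r == 1%N then p * ln ((m + p) / p)
                 else p / (r.-1)%:R * (1 - (p / (m + p)) ^+ r.-1))
      & abm_G psi m = (m + p) * expR (- abm_sum p r m)].
Proof.
have pN0 : p != 0 by rewrite gt_eqF.
have p0N0 : 0 + p != 0 by rewrite add0r.
have itv0 (x : R) : 0 < x -> x \in `]0, +oo[ by rewrite in_itv/= andbT.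
move=> m m0; have mp0 : 0 < m + p by rewrite addr_gt0.
(* [G] is the claimed form of G_p; [lnE] obtains it from the primitive whose additive constant is
   zero. *)
pose G x := (x + p) * expR (- abm_sum p r x).
have lnE x : 0 < x -> x * expR (- (ln x - ln (x + p) + abm_sum p r x)) = G x.
  move=> x0; rewrite /G opprD opprB expRD expRB !lnK ?posrE ?addr_gt0//.
  by field; rewrite gt_eqF.
have G_lim : G x @[x --> 0^'+] --> p.
  have -> : p = (0 + p) * expR (- abm_sum p r 0).
    by rewrite abm_sum0// oppr0 expR0 mulr1 add0r.
  apply: cvgM.
    by apply: cvgD; [exact: cvg_at_right_filter|exact: cvg_cst].
  apply: continuous_cvg; first exact: continuous_expR.
  apply: cvgN; apply: is_derive_continuous_at_right.
  exact: is_derive_abm_sum.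
have psiE : psi m = ln m - ln (m + p) + abm_sum p r m.
  pose c := psi m - (ln m - ln (m + p) + abm_sum p r m).
  have psi_c x : 0 < x -> psi x = ln x - ln (x + p) + abm_sum p r x + c.
    move=> x0; apply/eqP; rewrite [_ + c]addrC -subr_eq; apply/eqP.
    exact: (primitive_on_subr_const psi_primitive
      (primitive_abm_psi p_gt0 r_ge1) (itv0 _ x0) (itv0 _ m0)).
  (* The same function has two limits at 0+: p by the normalization of [psi], and p e^(-c) because
     [G] tends to p. Hence e^(-c) = 1 and c = 0. *)
  have Gc_p : G x * expR (- c) @[x --> 0^'+] --> p.
    apply: eq_cvg_at_right psi_lim => x x0.
    by rewrite psi_c// opprD expRD mulrA lnE.
  have Gc_pc : G x * expR (- c) @[x --> 0^'+] --> p * expR (- c).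
    by apply: cvgM => //; exact: cvg_cst.
  have : p * 1 = p * expR (- c).
    by rewrite mulr1; exact: (cvg_unique _ Gc_p Gc_pc).
  rewrite -expR0 => /(mulfI pN0)/expR_inj/esym/eqP.
  by rewrite oppr_eq0 subr_eq0 => /eqP.
split.
- by rewrite psiE ln_div ?posrE.
- have phi_abm : primitive_on `]0, +oo[ (fun m => m / abm_variance p r m)
      (abm_phi p r).
    move=> x /=; rewrite in_itv/= andbT => x0.
    have xp0 : 0 < x + p by rewrite addr_gt0.
    apply: (is_derive_eq (is_derive_abm_phi p_gt0 xp0 r_ge1)).
    by rewrite abm_varianceV// [RHS]mulrC divfK// gt_eqF.
  have phi_c x : 0 < x -> phi x - abm_phi p r x = phi m - abm_phi p r m.
    by move=> x0; apply: (primitive_on_subr_const phi_primitive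
      phi_abm); exact: itv0.
  (* The difference is constant on the positive axis and tends to 0 at 0+, so the constant is 0. *)
  have : phi x - abm_phi p r x @[x --> 0^'+] --> 0 - abm_phi p r 0.
    apply: cvgB => //; apply: is_derive_continuous_at_right.
    by apply: is_derive_abm_phi => //; rewrite add0r.
  rewrite abm_phi0// subr0 => /(eq_cvg_at_right phi_c) phi_diff.
  apply/eqP; rewrite -[X in _ == X]/(abm_phi p r m) -subr_eq0; apply/eqP.
  exact: (cvg_unique _ (cvg_cst _) phi_diff).
- by rewrite /abm_G psiE lnE.
Qed.
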